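(* Let $f:\mathbb{R}\times\mathbb{R}^n\to\mathbb{R}^n$ satisfy, for some $L_f>0$, $$\|f(t_1,x_1)-f(t_2,x_2)\|\le L_f|t_1-t_2|+L_f\|x_1-x_2\|\quad\text{for all } t_1,t_2\in\mathbb{R},\ x_1,x_2\in\mathbb{R}^n.$$ Assume that, for every $t\in\mathbb{R}$, the set $C(t)\subset\mathbb{R}^n$ is nonempty, closed and convex, and that for some $L_C>0$ $$d_H(C(t_1),C(t_2))\le L_C|t_1-t_2|\quad\text{for all } t_1,t_2\in\mathbb{R}.$$ If $C$ is globally bounded, i.e. there is $M>0$ such that $\|c\|\le M$ for all $c\in C(t)$ and all $t\in\mathbb{R}$, then the sweeping process $$-\dot x(t)\in N_{C(t)}(x(t))+f(t,x(t))$$ admits at least one absolutely continuous solution $x_0$ defined on the entire $\mathbb{R}$.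
   Context: For a closed convex set $C\subset\mathbb{R}^n$, the outward normal cone is $N_C(x)=\{\xi\in\mathbb{R}^n:\langle\xi,c-x\rangle\le 0\text{ for all }c\in C\}$ if $x\in C$ and $N_C(x)=\emptyset$ if $x\notin C$. The Hausdorff distance between closed sets is $d_H(C_1,C_2)=\max\{\sup_{x\in C_2}\mathrm{dist}(x,C_1),\sup_{x\in C_1}\mathrm{dist}(x,C_2)\}$ with $\mathrm{dist}(x,C)=\inf\{\|x-c\|:c\in C\}$. A solution of the sweeping process on an interval $I\subseteq\mathbb{R}$ is a function $x:I\to\mathbb{R}^n$, absolutely continuous on every compact subinterval of $I$, with $x(t)\in C(t)$ for all $t\in I$, that satisfies the inclusion for almost every $t\in I$. *)

(* Defs.v *)
From HB Require Import structures.
From mathcomp Require Import all_boot all_order all_algebra.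
From mathcomp Require Import all_classical all_reals all_analysis.

Set Implicit Arguments.
Unset Strict Implicit.
Unset Printing Implicit Defensive.

Import Order.TTheory GRing.Theory Num.Theory.
Import numFieldNormedType.Exports.

Local Open Scope classical_set_scope.
Local Open Scope ring_scope.

Definition dotp (R : realType) (n : nat) (u v : 'rV[R]_n) : R :=
  \sum_(i < n) u ord0 i * v ord0 i.

(* The library norm `|u| on 'rV[R]_n is the sup norm; the Euclidean norm is
   equivalent to it, so topological notions and derivatives in 'rV[R]_n are
   the usual ones of R^n. *)
Definition enorm (R : realType) (n : nat) (u : 'rV[R]_n) : R :=
  Num.sqrt (dotp u u).

Definition normal_cone (R : realType) (n : nat) (C : set 'rV[R]_n)
    (x : 'rV[R]_n) : set 'rV[R]_n :=
  [set xi | C x /\ forall c, C c -> dotp xi (c - x) <= 0].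

(* Distances take values in \bar R: the real-valued inf and sup of the library
   return 0 on sets that are empty or unbounded. *)
Definition dist (R : realType) (n : nat) (x : 'rV[R]_n) (C : set 'rV[R]_n) :
    \bar R :=
  ereal_inf [set (enorm (x - c))%:E | c in C].

Definition hausdorff_dist (R : realType) (n : nat) (C1 C2 : set 'rV[R]_n) :
    \bar R :=
  Order.max (ereal_sup [set dist x C1 | x in C2])
            (ereal_sup [set dist x C2 | x in C1]).

Definition abs_continuous_on (R : realType) (n : nat) (a b : R)
    (x : R -> 'rV[R]_n) : Prop :=
  forall e : R, 0 < e -> exists2 d : R, 0 < d &
    forall (m : nat) (s t : 'I_m -> R),
      (forall k, [/\ a <= s k, s k <= t k & t k <= b]) ->
      trivIset setT (fun k : 'I_m => `]s k, t k[%classic) ->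
      \sum_(k < m) (t k - s k) < d ->
      \sum_(k < m) enorm (x (t k) - x (s k)) < e.

(* A function on I is represented by a total function whose values outside I
   are irrelevant: the derivative below is two-sided, hence only depends on x
   inside I except at the endpoints of I, which are negligible. *)
Definition sweeping_solution (R : realType) (n : nat)
    (f : R -> 'rV[R]_n -> 'rV[R]_n) (C : R -> set 'rV[R]_n) (I : set R)
    (x : R -> 'rV[R]_n) : Prop :=
  [/\ forall a b : R, a <= b -> `[a, b] `<=` I -> abs_continuous_on a b x,
      forall t : R, I t -> C t (x t)
    & {ae lebesgue_measure, forall t : R, I t ->
        derivable x t 1 /\
        [set xi + f t (x t) | xi in normal_cone (C t) (x t)] (- (x^`()%classic t))}].

(* Main.v *)
(* A curve [x] in the moving set is estimated by two inequalities between two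
   times [s <= t]: a local Lipschitz bound, and
     <x(s) - x(t) - (t - s) f(s, x(s)), c - x(s)> <= E (t - s)^2  for c in C(s),
   an integrated form of the inclusion. The catching-up scheme
   x(t') = proj_C(t') (x(t) - (t' - t) f(t, x(t))) on an arbitrary finite set of
   times satisfies both, with constants that depend neither on the mesh nor on
   the number of times. Each estimate is a closed condition for pointwise
   convergence, so Tychonoff's theorem on the product of the compact sets C(t)
   gives a curve on the whole line satisfying all of them at once. It is locally
   Lipschitz, hence derivable almost everywhere, and dividing the second
   inequality by t - s and letting t decrease to s gives the inclusion at s.
   Almost everywhere derivability of a locally Lipschitz function comes from
   Radon-Nikodym and Lebesgue differentiation: after adding a linear function
   and clamping, it is the distribution function of a Lebesgue-Stieltjes measure
   dominated by a multiple of the Lebesgue measure. *)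

Require Import Defs.
From HB Require Import structures.
From mathcomp Require Import all_boot all_order all_algebra.
From mathcomp Require Import all_classical all_reals all_analysis.

Set Implicit Arguments.
Unset Strict Implicit.
Unset Printing Implicit Defensive.

From mathcomp Require Import ring lra.
Import Order.TTheory GRing.Theory Num.Theory.
Import numFieldNormedType.Exports.

Local Open Scope classical_set_scope.
Local Open Scope ring_scope.

(** * Almost everywhere differentiability of locally Lipschitz functions *)

Lemma lebesgue_stieltjes_measure_lip (R : realType) (g : cumulative R R)
    (K : R) (K_gt0 : 0 < K)
    (g_lip : forall x y, x <= y -> g y - g x <= K * (y - x)) (A : set R) :
  (lebesgue_stieltjes_measure g A <= K%:E * lebesgue_measure A)%E.
Proof.
rewrite /lebesgue_measure /lebesgue_stieltjes_measure /measure_extension.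
rewrite /mu_ext -ereal_inf_pZl//.
(* Both sides are infima over countable covers by half-open intervals; a cover [F] for the right
   side is reused on the left and compared interval by interval. *)
apply: le_ereal_inf_tmp => _ [_ [F [mF AF]] <-] <-.
apply: (@le_trans _ _ (\sum_(k <oo) wlength g (F k))%E).
  by apply: ereal_inf_lbound; exists F.
rewrite -nneseriesZl//.
apply: lee_nneseries => // k; rewrite ?inE.
move: (mF k) => /ocitvP[->|[[a b]/= ab ->]] _.
  by rewrite wlength0 [X in (_ * X)%E]wlength0 mule0.
rewrite wlength_itv_bnd ?(ltW ab)// [X in (_ * X)%E]wlength_itv_bnd ?(ltW ab)//.
by rewrite -EFinM lee_fin g_lip// ltW.
Qed.

(** On a bounded window the Stieltjes measure of [g] is finite and has a density; up to a constant,
    [g] is there the indefinite integral of this density, so [FTC1] applies. *)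
Lemma lipschitz_cumulative_derivable_ae (R : realType) (g : cumulative R R)
    (K : R) (K_gt0 : 0 < K)
    (g_lip : forall x y, x <= y -> g y - g x <= K * (y - x)) :
  {ae lebesgue_measure, forall x : R, derivable g x 1}.
Proof.
pose mu := @lebesgue_measure R.
pose nu : {measure set (measurableTypeR R) -> \bar R} :=
  lebesgue_stieltjes_measure g.
have nu_mu A : (nu A <= K%:E * mu A)%E.
  exact: lebesgue_stieltjes_measure_lip.
suff bounded_ae (N : nat) : {ae mu, forall x : R, - N%:R < x < N%:R ->
    derivable g x 1}.
  have := ae_foralln bounded_ae; apply: filterS => x dx.
  apply: (dx (Num.bound x)).
  by rewrite ltrNl unstable.ltrNbound unstable.ltr_bound.
pose D : set (measurableTypeR R) := `]- N%:R, N%:R]%classic.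
have mD : measurable D by exact: measurable_itv.
have nuDoo : (nu D < +oo)%E.
  apply: (le_lt_trans (nu_mu _)).
  by rewrite /mu lebesgue_measure_itv/=; case: ifP => _; rewrite ?mule0 ?ltry.
pose nuD := mfrestr mD nuDoo.
have nuD_mu : nuD `<< mu.
  apply/null_content_dominatesP => A mA muA0.
  apply/eqP; rewrite -measure_le0 /nuD /mfrestr /mrestr.
  apply: (@le_trans _ _ (nu A)).
    by apply: le_measure; rewrite ?inE//; exact: measurableI.
  by apply: (le_trans (nu_mu _)); rewrite [mu A]muA0 mule0.
have [phi [phi_ge0 phi_fin phi_int nuDE]] := radon_nikodym_sigma_finite nuD_mu.
pose psi := fine \o phi.
have psiE : EFin \o psi = phi.
  by apply/funext => x; rewrite /psi /= fineK.
have psi_int A : measurable A -> mu.-integrable A (EFin \o psi).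
  by move=> mA; rewrite psiE; exact: integrableS phi_int.
(* The left bound [BRight (- N%:R)] is open, so the integral runs over the half-open interval whose
   Stieltjes measure is [g y - g (- N%:R)]. *)
have := @FTC1 R psi (BRight (- N%:R)) (fun y => psi_int _ (measurable_itv _)).
move=> /(_ (open_integrable_locally openT (psi_int _ measurableT))).
apply: filterS; first exact: (ae_filter_ringOfSetsType lebesgue_measure).
move=> x dpsi /andP[Nx xN].
have [] := dpsi; first exact: Nx.
set F := (F in derivable F x 1) => dF _.
have gF : {near x, (fun y => F y + g (- N%:R)) =1 g}.
  near=> y.
  have /andP[Ny yN] : - N%:R < y < N%:R.
    apply/andP; split; near: y; [exact: lt_nbhsr|exact: lt_nbhsl].
  rewrite /F /Rintegral; under eq_integral do rewrite fineK ?phi_fin//.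
  rewrite -nuDE; last exact: measurable_itv.
  rewrite -[X in fine X]/(nu (`]- N%:R, y]%classic `&` D)) setIidl; last first.
    move=> z; rewrite /D /= !in_itv/= => /andP[-> zy] /=.
    exact: le_trans zy (ltW yN).
  have -> : nu `]- N%:R, y]%classic = (g y - g (- N%:R))%:E.
    rewrite -(wlength_itv_bnd g false false (ltW Ny)).
    by apply: measurable_mu_extE; exact: is_ocitv.
  by rewrite /= subrK.
apply: (near_eq_derivable gF).
by apply: derivableD => //; exact: derivable_cst.
Unshelve. all: by end_near. Qed.

(** Clamping the argument by [c] makes the Lipschitz bound global, and adding [L * x] makes the
    function nondecreasing; neither affects derivability strictly between [- N%:R] and [N%:R]. *)
Lemma locally_lipschitz_derivable_ae (R : realType) (f : R -> R) (K : R -> R)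
    (f_lip : forall T x y, - T <= x -> x <= y -> y <= T ->
      `|f y - f x| <= K T * (y - x)) :
  {ae lebesgue_measure, forall x : R, derivable f x 1}.
Proof.
suff bounded_ae (N : nat) : {ae lebesgue_measure, forall x : R,
    - N%:R < x < N%:R -> derivable f x 1}.
  have := ae_foralln bounded_ae; apply: filterS => x dx.
  apply: (dx (Num.bound x)).
  by rewrite ltrNl unstable.ltrNbound unstable.ltr_bound.
pose L := `|K N%:R| + 1.
have L_gt0 : 0 < L by rewrite ltr_wpDl.
pose c (x : R) := Num.max (- N%:R) (Num.min x N%:R).
have cN x : - N%:R <= c x by rewrite le_max lexx.
have cN' x : c x <= N%:R by rewrite ge_max ge_min lexx orbT andbT ge0_cp.
have cE x : - N%:R < x < N%:R -> c x = x.
  by move=> /andP[x1 x2]; rewrite /c min_l ?max_r ?ltW.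
have c_nd x y : x <= y -> c x <= c y.
  move=> xy; rewrite /c ge_max le_max lexx /= le_max.
  by apply/orP; right; rewrite le_min ge_min xy/= ge_min lexx orbT.
have c_lip x y : x <= y -> c y - c x <= y - x.
  move=> xy; rewrite /c /Num.max /Num.min.
  by repeat case: ifPn; rewrite -?leNgt; lra.
have fc_lip x y : x <= y -> `|f (c y) - f (c x)| <= L * (y - x).
  move=> xy; apply: le_trans (f_lip _ _ _ (cN x) (c_nd _ _ xy) (cN' y)) _.
  apply: (@le_trans _ _ (L * (c y - c x))); last by rewrite ler_pM2l// c_lip.
  rewrite ler_wpM2r ?subr_ge0 ?c_nd// /L; apply: (le_trans (ler_norm _)).
  by rewrite lerDl.
pose g x := f (c x) + L * x.
have g_nd : nondecreasing g.
  move=> x y xy; have := fc_lip _ _ xy; rewrite ler_norml /g => /andP[+ _].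
  lra.
have g_lip x y : x <= y -> g y - g x <= (L + L) * (y - x).
  move=> xy; have := fc_lip _ _ xy; rewrite ler_norml /g => /andP[_].
  lra.
have L2_gt0 : 0 < L + L by rewrite addr_gt0.
have g_rc : right_continuous g.
  apply: right_continuousW => x; apply/cvgrPdist_le => e e0; near=> y.
  have xy : `|x - y| <= e / (L + L).
    by near: y; apply: cvgr_dist_le => //; rewrite divr_gt0.
  have {}xy : (L + L) * `|x - y| <= e by rewrite mulrC -ler_pdivlMr.
  apply: le_trans xy; have [yx|/ltW yx] := leP y x.
    by rewrite !ger0_norm ?subr_ge0 ?g_nd// g_lip.
  by rewrite !ler0_norm ?subr_le0 ?g_nd// !opprB g_lip.
pose G : cumulative R R := HB.pack_for (cumulative R R) g
  (isCumulative.Build R _ R g g_nd g_rc).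
have := @lipschitz_cumulative_derivable_ae R G (L + L) L2_gt0 g_lip.
apply: filterS; first exact: (ae_filter_ringOfSetsType lebesgue_measure).
move=> x dg /andP[Nx xN].
have gf : {near x, (fun y => g y - L * y) =1 f}.
  near=> y; rewrite /g addrK cE//.
  by apply/andP; split; near: y; [exact: lt_nbhsr|exact: lt_nbhsl].
by apply: (near_eq_derivable gf); apply: derivableB.
Unshelve. all: by end_near. Qed.

(** * Euclidean inner product and norm *)

Section euclidean.
Context {R : realType} {n : nat}.
Implicit Types (u v w : 'rV[R]_n) (a b : R).

Lemma dotpC u v : dotp u v = dotp v u.
Proof. by apply: eq_bigr => i _; rewrite mulrC. Qed.

Lemma dotpDl u v w : dotp (u + v) w = dotp u w + dotp v w.
Proof. by rewrite -big_split; apply: eq_bigr => i _; rewrite mxE mulrDl. Qed.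

Lemma dotpZl a u v : dotp (a *: u) v = a * dotp u v.
Proof. by rewrite mulr_sumr; apply: eq_bigr => i _; rewrite mxE mulrA. Qed.

Lemma dotpNl u v : dotp (- u) v = - dotp u v.
Proof. by rewrite -scaleN1r dotpZl mulN1r. Qed.

Lemma dotpBl u v w : dotp (u - v) w = dotp u w - dotp v w.
Proof. by rewrite dotpDl dotpNl. Qed.

Lemma dotpDr u v w : dotp u (v + w) = dotp u v + dotp u w.
Proof. by rewrite !(dotpC u) dotpDl. Qed.

Lemma dotpBr u v w : dotp u (v - w) = dotp u v - dotp u w.
Proof. by rewrite !(dotpC u) dotpBl. Qed.

Lemma dotpZr a u v : dotp u (a *: v) = a * dotp u v.
Proof. by rewrite !(dotpC u) dotpZl. Qed.

Lemma dotp_ge0 u : 0 <= dotp u u.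
Proof. by apply: sumr_ge0 => i _; rewrite -expr2 sqr_ge0. Qed.

Lemma dotp_sqrB u v :
  dotp (u - v) (u - v) = dotp u u - 2 * dotp u v + dotp v v.
Proof. by rewrite dotpBl !dotpBr (dotpC v u); ring. Qed.

Lemma enorm_ge0 u : 0 <= enorm u.
Proof. exact: sqrtr_ge0. Qed.

Lemma sqr_enorm u : enorm u ^+ 2 = dotp u u.
Proof. by rewrite sqr_sqrtr// dotp_ge0. Qed.

Lemma enorm_eq0 u : enorm u = 0 -> u = 0.
Proof.
move=> u0; have : dotp u u = 0 by rewrite -sqr_enorm u0 expr0n.
move=> /eqP; rewrite psumr_eq0 => [/allP du|i _]; last first.
  by rewrite -expr2 sqr_ge0.
apply/rowP => i; have := du i (mem_index_enum i).
by rewrite implyTb mulf_eq0 orbb mxE ord1 => /eqP.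
Qed.

Lemma enormZ a u : enorm (a *: u) = `|a| * enorm u.
Proof.
by rewrite /enorm dotpZl dotpZr mulrA -expr2 sqrtrM ?sqr_ge0// sqrtr_sqr.
Qed.

Lemma enormN u : enorm (- u) = enorm u.
Proof. by rewrite -scaleN1r enormZ normrN1 mul1r. Qed.

Lemma enormB u v : enorm (u - v) = enorm (v - u).
Proof. by rewrite -enormN opprB. Qed.

Lemma enorm0 : enorm (0 : 'rV[R]_n) = 0.
Proof. by rewrite -(scale0r 0) enormZ normr0 mul0r. Qed.

Lemma cauchy_schwarz u v : dotp u v <= enorm u * enorm v.
Proof.
have [u0|u0] := eqVneq (enorm u) 0.
  by rewrite (enorm_eq0 u0) -(scale0r 0) dotpZl enormZ normr0 !mul0r.
have [v0|v0] := eqVneq (enorm v) 0.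
  by rewrite (enorm_eq0 v0) -(scale0r 0) dotpZr enormZ normr0 !mul0r mulr0.
have p_gt0 : 0 < enorm u * enorm v.
  by rewrite mulr_gt0// lt_def ?u0 ?v0 enorm_ge0.
(* With p = |u| |v|, this square expands to 2 p^2 - 2 p <u, v>; dividing by p gives the claim. *)
have := dotp_ge0 (enorm v *: u - enorm u *: v).
rewrite dotpBl !dotpBr !dotpZl !dotpZr (dotpC v u) -!sqr_enorm => h.
by rewrite -(ler_pM2l p_gt0); lra.
Qed.

Lemma enorm_triangle u v : enorm (u + v) <= enorm u + enorm v.
Proof.
rewrite -(@ler_pXn2r _ 2)// ?nnegrE ?addr_ge0 ?enorm_ge0//.
rewrite sqr_enorm dotpDl !dotpDr (dotpC v u) sqrrD -!sqr_enorm.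
by have := cauchy_schwarz u v; lra.
Qed.

Lemma enorm_triangle_mid w u v : enorm (u - v) <= enorm (u - w) + enorm (w - v).
Proof. by rewrite -(subrKA w) enorm_triangle. Qed.

(** Since the topology comes from the sup norm, this turns Euclidean estimates into boundedness,
    continuity and coordinate bounds. *)
Lemma mx_norm_le_enorm u : `|u| <= enorm u.
Proof.
rewrite [leLHS]/Num.Def.normr/= mx_normrE.
apply: bigmax_le; first exact: enorm_ge0.
move=> [i j] _ /=; rewrite (ord1 i) -sqrtr_sqr ler_wsqrtr//.
rewrite /dotp (bigD1 j)//= expr2 lerDl.
by apply: sumr_ge0 => k _; rewrite -expr2 sqr_ge0.
Qed.

Lemma dotp_continuous (T : topologicalType) (f g : T -> 'rV[R]_n) :
  continuous f -> continuous g -> continuous (fun x => dotp (f x) (g x)).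
Proof.
move=> cf cg x; rewrite /continuous_at /dotp.
elim: (index_enum _) => [|i r ih].
  by under eq_fun do rewrite big_nil; rewrite big_nil; exact: cvg_cst.
under eq_fun do rewrite big_cons.
rewrite big_cons; apply: cvgD => //; apply: cvgM.
  exact: (cvg_comp _ _ (cf x) (@coord_continuous R 1 n ord0 i (f x))).
exact: (cvg_comp _ _ (cg x) (@coord_continuous R 1 n ord0 i (g x))).
Qed.

Lemma enorm_continuous (T : topologicalType) (f : T -> 'rV[R]_n) :
  continuous f -> continuous (fun x => enorm (f x)).
Proof.
move=> cf x.
apply: (@continuous_comp _ _ _ (fun x => dotp (f x) (f x)) Num.sqrt).
  exact: dotp_continuous.
exact: sqrt_continuous.
Qed.

Lemma enorm_dist_continuous u : continuous (fun v => enorm (u - v)).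
Proof.
apply: enorm_continuous => v.
by apply: continuousB; [exact: cst_continuous|exact: cvg_id].
Qed.

End euclidean.

(** * Projection onto convex sets and Hausdorff distance *)

Section convex_geometry.
Context {R : realType} {n : nat}.
Implicit Types (C : set 'rV[R]_n) (x y c : 'rV[R]_n).

Lemma euclidean_bounded_closed_compact C (M : R) :
  closed C -> (forall c, C c -> enorm c <= M) -> compact C.
Proof.
move=> C_closed C_bounded; apply: bounded_closed_compact => //.
exists M; split; first exact: num_real.
move=> r Mr c /C_bounded cM /=.
exact: le_trans (mx_norm_le_enorm _) (le_trans cM (ltW Mr)).
Qed.

Lemma convex_set_segment C x y (l : R) :
  convex_set (C : set (convex_lmodType 'rV[R]_n)) -> C x -> C y ->
  0 <= l <= 1 -> C (y + l *: (x - y)).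
Proof.
move=> C_convex Cx Cy /andP[l0 l1].
have l01 : Itv.spec (@Itv.num_sem R) (Itv.Real `[0%Z, 1%Z]) l.
  by rewrite /= /Itv.num_sem/= num_real in_itv/= l0 l1.
have := C_convex x y (Itv.mk l01); rewrite !inE => /(_ Cx Cy).
rewrite /conv/= /unstable.onem scalerBl scale1r scalerBr.
by congr C; rewrite [RHS]addrCA.
Qed.

(** Compactness yields a nearest point. The last property places [y - z] in the normal cone of [C]
    at [z], which is how the cone enters the scheme. *)
Lemma exists_projection C (M : R) y :
  C !=set0 -> closed C -> convex_set (C : set (convex_lmodType 'rV[R]_n)) ->
  (forall c, C c -> enorm c <= M) ->
  exists z, [/\ C z, forall c, C c -> enorm (y - z) <= enorm (y - c)
    & forall c, C c -> dotp (y - z) (c - z) <= 0].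
Proof.
move=> C0 C_closed C_convex C_bounded.
have C_compact := euclidean_bounded_closed_compact C_closed C_bounded.
have dist_cont : {within C, continuous (fun c => enorm (y - c))}.
  by apply: continuous_subspaceT; exact: enorm_dist_continuous.
have [z /[!inE] Cz z_min] := EVT_min_rV C0 C_compact dist_cont.
exists z; split=> // [c Cc|c Cc]; first by apply: z_min; rewrite inE.
rewrite leNgt; apply/negP => p_gt0.
set p := dotp _ _ in p_gt0; pose q := dotp (c - z) (c - z).
have q_ge0 : 0 <= q by exact: dotp_ge0.
(* moving from [z] towards [c] by the factor [p / (p + q)] strictly decreases
   the squared distance to [y] *)
pose l := p / (p + q).
have pq_gt0 : 0 < p + q by rewrite ltr_wpDr.
have l_gt0 : 0 < l by rewrite divr_gt0.
have l_le1 : l <= 1 by rewrite ler_pdivrMr// mul1r lerDl.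
have := z_min (z + l *: (c - z)).
rewrite inE => /(_ (convex_set_segment C_convex Cc Cz _)).
rewrite l_le1 ltW// => /(_ isT); apply/negP; rewrite -ltNge.
rewrite -(@ltr_pXn2r _ 2)// ?nnegrE ?enorm_ge0// !sqr_enorm.
rewrite opprD addrA (dotp_sqrB (y - z)) !dotpZr dotpZl -/p -/q.
(* Hence the squared distance changes by -2 l p + l^2 q = - l p - l^2 p < 0. *)
have lq : l * q = p - l * p.
  by rewrite -[p in p - _](divfK (lt0r_neq0 pq_gt0)) -/l mulrDr addrC addKr.
rewrite lq.
have : 0 < l * p by exact: mulr_gt0.
have : 0 < l * (l * p) by apply: mulr_gt0 => //; exact: mulr_gt0.
by nra.
Qed.

(** The slack between [r] and [s] replaces the infimum in [dist] by an actual point. *)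
Lemma hausdorff_dist_near C1 C2 (r s : R) x :
  (hausdorff_dist C1 C2 <= r%:E)%E -> r < s -> C2 x ->
  exists2 c, C1 c & enorm (x - c) <= s.
Proof.
move=> C12 rs C2x.
have : (dist x C1 < s%:E)%E.
  apply: le_lt_trans (_ : (r%:E < s%:E)%E); last by rewrite lte_fin.
  apply: le_trans C12; rewrite /hausdorff_dist le_max; apply/orP; left.
  by apply: ereal_sup_ubound; exists x.
move=> /ereal_inf_lt[_ [c C1c <-]]; rewrite lte_fin => /ltW xc.
by exists c.
Qed.

End convex_geometry.

(** * The catching-up scheme and its mesh-independent estimates *)

Section catching_up.
Context {R : realType} {n : nat}.
Context (f : R -> 'rV[R]_n -> 'rV[R]_n) (C : R -> set 'rV[R]_n) (Lf LC M : R).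
Hypothesis Lf_gt0 : 0 < Lf.
Hypothesis f_lip : forall t1 t2 x1 x2,
  enorm (f t1 x1 - f t2 x2) <= Lf * `|t1 - t2| + Lf * enorm (x1 - x2).
Hypothesis C_nonempty : forall t, C t !=set0.
Hypothesis C_closed : forall t, closed (C t).
Hypothesis C_convex :
  forall t, convex_set (C t : set (convex_lmodType 'rV[R]_n)).
Hypothesis LC_gt0 : 0 < LC.
Hypothesis C_lip : forall t1 t2,
  (hausdorff_dist (C t1) (C t2) <= (LC * `|t1 - t2|)%:E)%E.
Hypothesis M_gt0 : 0 < M.
Hypothesis C_bounded : forall t c, C t c -> enorm c <= M.

(** The factor 2 provides the slack of [hausdorff_dist_near]; at [s = t] that slack vanishes and [x]
    itself serves. *)
Lemma moving_set_near s t x : C s x ->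
  exists2 c, C t c & enorm (x - c) <= 2 * LC * `|t - s|.
Proof.
move=> Csx; have [<-|ts] := eqVneq s t.
  by exists x => //; rewrite !subrr enorm0 normr0 mulr0.
apply: hausdorff_dist_near (C_lip t s) _ Csx.
by rewrite ltr_pM2r ?normr_gt0 ?subr_eq0 1?eq_sym// ltr_pMl// ltr1n.
Qed.

(** Constants are indexed by a window from [- T] to [T], because [f] may grow linearly in time. *)
Definition drift_bound T := enorm (f 0 0) + Lf * T + Lf * M.

Lemma drift_boundP T t x : - T <= t <= T -> enorm x <= M ->
  enorm (f t x) <= drift_bound T.
Proof.
move=> tT xM; rewrite -[f t x](subrK (f 0 0)) addrC.
apply: (le_trans (enorm_triangle _ _)); rewrite /drift_bound -addrA lerD2l.
apply: le_trans (f_lip _ _ _ _) _; rewrite !subr0.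
by apply: lerD; rewrite ler_pM2l// ler_norml.
Qed.

(** Over a time h the drift moves by at most [drift_bound T] times h, and projecting back moves by
    at most [2 * LC + drift_bound T] times h. *)
Definition speed_bound T := 2 * LC + 2 * drift_bound T.

Lemma drift_bound_ge0 T : 0 <= T -> 0 <= drift_bound T.
Proof.
by move=> T0; rewrite !addr_ge0 ?enorm_ge0// mulr_ge0// ltW.
Qed.

Lemma speed_bound_ge0 T : 0 <= T -> 0 <= speed_bound T.
Proof.
by move=> T0; rewrite addr_ge0 ?mulr_ge0 ?drift_bound_ge0// ltW.
Qed.

(** The first summand pays for moving the projection inequality from the new time back to [s], the
    second for the variation of [f] tested against a vector of norm at most [2 * M]. *)
Definition sweeping_error T :=
  speed_bound T * (2 * LC + speed_bound T)
  + 2 * M * (Lf * (1 + speed_bound T)).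

Definition sweeping_estimate T (x : R -> 'rV[R]_n) s t :=
  enorm (x t - x s) <= speed_bound T * (t - s) /\
  forall c, C s c -> dotp (x s - x t - (t - s) *: f s (x s)) (c - x s) <=
    sweeping_error T * (t - s) ^+ 2.

Lemma sweeping_estimate_refl T x s : sweeping_estimate T x s s.
Proof.
split=> [|c _]; first by rewrite !subrr mulr0 enorm0.
by rewrite !subrr scale0r subr0 expr0n mulr0 -(scale0r 0) dotpZl mul0r.
Qed.

(** [z] is the projection onto [C t'] of the drifted point. It is chosen before [T], so one curve
    serves all windows. *)
Lemma catching_up_step t t' y : t < t' -> C t y ->
  exists z, [/\ C t' z,
    forall T, - T <= t -> t' <= T ->
      enorm (z - y) <= speed_bound T * (t' - t) /\
      enorm (y - (t' - t) *: f t y - z) <= speed_bound T * (t' - t)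
  & forall c, C t' c -> dotp (y - (t' - t) *: f t y - z) (c - z) <= 0].
Proof.
move=> tt' Cty; set h := t' - t; set w := y - h *: f t y.
have h_gt0 : 0 < h by rewrite subr_gt0.
have [z [Cz z_min z_proj]] := exists_projection w (C_nonempty t')
  (@C_closed t') (@C_convex t') (@C_bounded t').
exists z; split=> // T Tt t'T.
have fy : enorm (f t y) <= drift_bound T.
  by apply: drift_boundP; [lra|exact: C_bounded Cty].
have B_ge0 : 0 <= drift_bound T by rewrite drift_bound_ge0//; lra.
have hfy : enorm (h *: f t y) <= drift_bound T * h.
  by rewrite enormZ gtr0_norm// mulrC ler_pM2r.
(* This [c] competes with [z] in the minimisation and so bounds the distance from [w] to [z]. *)
have [c Cc yc] := moving_set_near t' Cty.
rewrite -/h gtr0_norm// in yc.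
have wz : enorm (w - z) <= 2 * LC * h + drift_bound T * h.
  apply: le_trans (z_min _ Cc) _.
  rewrite /w addrAC; apply: le_trans (enorm_triangle _ _) _.
  by rewrite enormN lerD.
split; last by apply: (le_trans wz); rewrite /speed_bound; nra.
apply: le_trans (enorm_triangle_mid w _ _) _.
rewrite enormB /w [_ - y]addrAC subrr add0r enormN.
by rewrite /speed_bound; lra.
Qed.

(** The residual from [s] to [t'] splits into the residual up to [t], the projection residual [p] of
    the last step, and the change of drift [F - G] over that step. The last two cost at most
    [sweeping_error T * (t' - t) * (t' - s)]. *)
Lemma sweeping_estimate_extend T x x' s t t' :
  - T <= s -> s <= t -> t < t' -> t' <= T ->
  C s (x s) -> C t (x t) -> sweeping_estimate T x s t -> x' s = x s ->
  enorm (x' t' - x t) <= speed_bound T * (t' - t) ->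
  enorm (x t - (t' - t) *: f t (x t) - x' t') <= speed_bound T * (t' - t) ->
  (forall c, C t' c ->
    dotp (x t - (t' - t) *: f t (x t) - x' t') (c - x' t') <= 0) ->
  sweeping_estimate T x' s t'.
Proof.
move=> Ts st tt' t'T Cs Ct [lip_st est_st] x's zy pK z_proj.
rewrite /sweeping_estimate x's.
set z := x' t' in zy pK z_proj *.
set y := x t in Ct lip_st est_st zy pK z_proj *.
set u := x s in Cs lip_st est_st *.
set F := f t y in pK z_proj; set G := f s u in est_st *.
set K := speed_bound T in lip_st zy pK *.
have K_ge0 : 0 <= K by rewrite speed_bound_ge0//; lra.
have zu : enorm (z - u) <= K * (t' - s).
  apply: le_trans (enorm_triangle_mid y _ _) _.
  by apply: (le_trans (lerD zy lip_st)); lra.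
split=> // c Csc.
set p := y - (t' - t) *: F - z in pK z_proj.
have [c' Cc' cc'] := moving_set_near t' Csc.
have d_gt0 : 0 < t' - s by lra.
rewrite gtr0_norm// in cc'.
have -> : u - z - (t' - s) *: G =
    (u - y - (t - s) *: G) + p + (t' - t) *: (F - G).
  apply/rowP => i; rewrite !mxE; ring.
(* The projection inequality only tests [p] at points of [C t'], so [c] is traded for the nearby
   [c']; the leftover vector has norm at most [(2 * LC + K) * (t' - s)]. *)
have cu : c - u = (c' - z) + ((c - c') + (z - u)).
  by apply/rowP => i; rewrite !mxE; ring.
have pE : dotp p (c - u) = dotp p (c' - z) + dotp p (c - c' + (z - u)).
  by rewrite cu dotpDr.
rewrite 2!dotpDl pE dotpZl.
have pc' := z_proj _ Cc'.
have p2 : dotp p (c - c' + (z - u)) <=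
    K * (t' - t) * ((2 * LC + K) * (t' - s)).
  apply: le_trans (cauchy_schwarz _ _) _.
  apply: ler_pM => //; rewrite ?enorm_ge0//.
  by apply: le_trans (enorm_triangle _ _) _; rewrite mulrDl lerD.
have FG : dotp (F - G) (c - u) <= Lf * (1 + K) * (t' - s) * (2 * M).
  apply: le_trans (cauchy_schwarz _ _) _.
  apply: ler_pM; rewrite ?enorm_ge0//.
    apply: le_trans (f_lip _ _ _ _) _; rewrite ger0_norm ?subr_ge0//.
    rewrite -mulrDr -mulrA ler_pM2l//; nra.
  apply: le_trans (enorm_triangle _ _) _; rewrite enormN.
  by have := C_bounded Csc; have := C_bounded Cs; lra.
have := est_st _ Csc.
set E := sweeping_error T.
have E_ge0 : 0 <= E.
  have LC0 := ltW LC_gt0; have M0 := ltW M_gt0; have Lf0 := ltW Lf_gt0.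
  rewrite /E /sweeping_error -/K; move: (K) K_ge0 => k k_ge0.
  by rewrite !(addr_ge0, mulr_ge0).
have hFG : (t' - t) * dotp (F - G) (c - u) <=
    (t' - t) * (Lf * (1 + K) * (t' - s) * (2 * M)).
  by rewrite ler_pM2l// subr_gt0.
move=> est.
have sum_le : dotp (u - y - (t - s) *: G) (c - u)
    + (dotp p (c' - z) + dotp p (c - c' + (z - u)))
    + (t' - t) * dotp (F - G) (c - u) <=
    E * ((t - s) ^+ 2 + (t' - t) * (t' - s)).
  have -> : E * ((t - s) ^+ 2 + (t' - t) * (t' - s)) = E * (t - s) ^+ 2 +
      (0 + K * (t' - t) * ((2 * LC + K) * (t' - s))) +
      (t' - t) * (Lf * (1 + K) * (t' - s) * (2 * M)).
    rewrite /E /sweeping_error -/K; ring.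
  by rewrite !lerD.
(* With a = t - s and b = t' - t, a^2 + b (a + b) <= (a + b)^2: the constant does not grow with the
   number of steps. *)
apply: (le_trans sum_le); rewrite ler_wpM2l//.
by nra.
Qed.

(** Times are listed in decreasing order, so that the induction adds the latest time at the head.
    Off the list, [x] is an arbitrary selection of [C]. *)
Lemma finite_catching_up (l : seq R) : sorted (fun a b => b < a) l ->
  exists x : R -> 'rV[R]_n, (forall t, C t (x t)) /\
    forall T s t, s \in l -> t \in l -> - T <= s -> s <= t -> t <= T ->
      sweeping_estimate T x s t.
Proof.
elim: l => [_|t' l ih].
  by have [x xC] := choice C_nonempty; exists x; split.
case: l ih => [_ _|t l ih /= /andP[tt' l_sorted]].
  have [x xC] := choice C_nonempty; exists x; split=> // T s t.
  by rewrite !inE => /eqP-> /eqP-> _ _ _; exact: sweeping_estimate_refl.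
have [x [xC x_est]] := ih l_sorted.
have [z [Cz z_lip z_proj]] := catching_up_step tt' (xC t).
have l_lt s : s \in t :: l -> s <= t.
  rewrite inE => /predU1P[->//|sl].
  have gt_trans : transitive (fun a b : R => b < a).
    by move=> a b c ba ac; exact: lt_trans ac ba.
  by have /allP/(_ _ sl)/ltW := order_path_min gt_trans l_sorted.
pose x' r := if r == t' then z else x r.
have x't' : x' t' = z by rewrite /x' eqxx.
have x'E s : s \in t :: l -> x' s = x s.
  by move=> /l_lt st; rewrite /x' lt_eqF// (le_lt_trans st).
exists x'; split=> [r|T a b].
  by rewrite /x'; case: eqP => // ->.
rewrite inE => /predU1P[->|al]; rewrite inE => /predU1P[->|bl] Ta ab bT.
- exact: sweeping_estimate_refl.
- by have := l_lt _ bl; rewrite leNgt (lt_le_trans tt')// ab.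
- have at_ := l_lt _ al.
  have tl : t \in t :: l by rewrite mem_head.
  have [zy pK] := z_lip T (le_trans Ta at_) bT.
  apply: (@sweeping_estimate_extend T x x' a t t') => //;
    rewrite ?x't' ?x'E//.
  by apply: x_est => //; exact: le_trans (ltW tt') bT.
- by have := x_est T a b al bl Ta ab bT; rewrite /sweeping_estimate !x'E.
Qed.

(** * Passage to the whole line by compactness *)

Lemma drift_continuous t : continuous (f t).
Proof.
move=> x; apply/(@cvgrPdist_le _ _ _ (nbhs x) (nbhs_filter x)) => e e0.
have dist_cont :
    {for x, continuous (fun y : 'rV[R]_n => enorm ((x : 'rV_n) - y))}.
  exact: enorm_dist_continuous.
have /(@cvgrPdist_le _ _ _ (nbhs x) (nbhs_filter x)) := dist_cont.
move=> /(_ (e / Lf)); rewrite divr_gt0// => /(_ isT) near_x.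
near=> y; have : `|enorm (x - x) - enorm (x - y)| <= e / Lf by near: y.
rewrite subrr enorm0 sub0r normrN.
rewrite ger0_norm ?enorm_ge0// ler_pdivlMr// mulrC => xy.
apply: le_trans (mx_norm_le_enorm _) _; apply: le_trans (f_lip _ _ _ _) _.
by rewrite subrr normr0 mulr0 add0r.
Unshelve. all: by end_near. Qed.

(** Evaluations are continuous for the pointwise topology, and the estimate is an intersection of
    sublevel sets of continuous functions of [x s] and [x t]. *)
Lemma sweeping_estimate_closed T s t :
  closed [set x : {ptws R -> 'rV[R]_n} | sweeping_estimate T x s t].
Proof.
have eval_cont r : continuous (fun x : {ptws R -> 'rV[R]_n} => x r).
  exact: (@proj_continuous _ (fun=> 'rV[R]_n) r).
have increment_cont r r' :
    continuous (fun x : {ptws R -> 'rV[R]_n} => x r - x r').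
  by move=> x; apply: continuousB; exact: eval_cont.
have closed_sublevel (phi : {ptws R -> 'rV[R]_n} -> R) b :
    continuous phi -> closed [set x | phi x <= b].
  move=> phi_cont; rewrite -[X in closed X]/(phi @^-1` [set r | r <= b]).
  by apply: preimage_closed; [move=> ? _; exact: phi_cont|exact: closed_le].
rewrite [X in closed X](_ : _ =
  [set x | enorm (x t - x s) <= speed_bound T * (t - s)] `&`
  \bigcap_(c in C s)
    [set x | dotp (x s - x t - (t - s) *: f s (x s)) (c - x s) <=
      sweeping_error T * (t - s) ^+ 2]); last by [].
apply: closedI; [|apply: closed_bigI => c _]; apply: closed_sublevel.
  by apply: enorm_continuous; exact: increment_cont.
have drift_eval_cont :
    continuous (fun x : {ptws R -> 'rV[R]_n} => (t - s) *: f s (x s)).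
  move=> x; apply: continuousZr.
  exact: (cvg_comp _ _ (eval_cont s x) (drift_continuous (x := x s))).
have residual_cont : continuous (fun x : {ptws R -> 'rV[R]_n} =>
    x s - x t - (t - s) *: f s (x s)).
  by move=> x; exact: (continuousB (increment_cont s t x) (drift_eval_cont x)).
have offset_cont : continuous (fun x : {ptws R -> 'rV[R]_n} => c - x s).
  by move=> x; apply: continuousB; [exact: cst_continuous|exact: eval_cont].
exact: dotp_continuous residual_cont offset_cont.
Qed.

Lemma exists_sweeping_estimate : exists x : R -> 'rV[R]_n,
  (forall t, C t (x t)) /\ forall T s t, - T <= s -> s <= t -> t <= T ->
    sweeping_estimate T x s t.
Proof.
pose A := [set x : {ptws R -> 'rV[R]_n} | forall t, C t (x t)].
have A_compact : compact A.
  apply: (@tychonoff _ (fun=> 'rV[R]_n) C) => t.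
  by apply: euclidean_bounded_closed_compact => // c; exact: C_bounded.
pose E (p : R * R) := [set x : {ptws R -> 'rV[R]_n} |
  forall T, - T <= p.1 -> p.1 <= p.2 -> p.2 <= T ->
    sweeping_estimate T x p.1 p.2].
have E_closed p : closed (E p).
  rewrite [E p](_ : _ = \bigcap_(T in [set T | - T <= p.1 /\ p.1 <= p.2 <= T])
    [set x | sweeping_estimate T x p.1 p.2]).
    by apply: closed_bigI => T _; exact: sweeping_estimate_closed.
  apply/seteqP; split=> [x xE T [Tp /andP[pp pT]]|x xE T Tp pp pT].
    exact: xE.
  by apply: xE; split=> //; rewrite pp.
have AE_finI : finI setT (fun p => A `&` E p).
  (* All endpoints of the finitely many pairs go into one list; [undup] makes the sorted order
     strict. *)
  move=> D _; pose r : seq (R * R) := finmap.enum_fset D.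
  pose l := rev (sort <=%R (undup ([seq p.1 | p <- r] ++ [seq p.2 | p <- r]))).
  have l_sorted : sorted (fun a b => b < a) l.
    by rewrite rev_sorted sort_lt_sorted undup_uniq.
  have [x [xC x_est]] := finite_catching_up l_sorted.
  exists x => p /= pD; split=> // T; apply: x_est.
    by rewrite mem_rev mem_sort mem_undup mem_cat map_f.
  by rewrite mem_rev mem_sort mem_undup mem_cat [X in _ || X]map_f ?orbT.
(* A cluster point of this filter in the compact [A] lies in every closed [E p]. *)
pose F := filter_from (finI_from setT (fun p => A `&` E p)) id.
have F_proper : ProperFilter F by exact: finI_filter.
have F_AE p : F (A `&` E p) by exists (A `&` E p) => //; exact: finI_from1.
have [|x [xA x_cluster]] := A_compact F _.
  by apply: filterS (F_AE (0, 0)) => x [].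
exists x; split=> // T s t; apply: (E_closed (s, t)) => B xB.
by apply: x_cluster xB; apply: filterS (F_AE (s, t)) => y [].
Qed.

End catching_up.

(** * Regularity of locally Lipschitz curves *)

Section locally_lipschitz_curves.
Context {R : realType} {n : nat} (x : R -> 'rV[R]_n) (K : R -> R).
Hypothesis x_lip : forall T s t, - T <= s -> s <= t -> t <= T ->
  enorm (x t - x s) <= K T * (t - s).

Lemma locally_lipschitz_abs_continuous a b : abs_continuous_on a b x.
Proof.
(* The window given by [T] contains both [a] and [b]; the added 1 makes [L] positive whatever the
   value of [K T]. *)
move=> e e_gt0; pose T := `|a| + `|b|; pose L := `|K T| + 1.
have L_gt0 : 0 < L by rewrite ltr_wpDl.
exists (e / L); first exact: divr_gt0.
move=> m s t st _ sum_lt.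
apply: (@le_lt_trans _ _ (L * \sum_(k < m) (t k - s k))).
  rewrite mulr_sumr; apply: ler_sum => k _; have [ask skt tkb] := st k.
  have TK : K T <= L by rewrite (le_trans (ler_norm _))// lerDl.
  apply: (@le_trans _ _ (K T * (t k - s k))); last first.
    by rewrite ler_wpM2r ?subr_ge0.
  apply: x_lip => //.
    apply: le_trans ask; rewrite /T opprD.
    by rewrite (le_trans _ (lerNnormlW (lexx _)))// gerDl oppr_le0.
  by apply: (le_trans tkb); rewrite (le_trans (ler_norm _))// lerDr.
by rewrite mulrC -ltr_pdivlMr.
Qed.

Lemma locally_lipschitz_curve_derivable_ae :
  {ae lebesgue_measure, forall t : R, derivable x t 1}.
Proof.
have coord_ae (j : 'I_n) :
    {ae lebesgue_measure, forall t : R, derivable (fun r => x r ord0 j) t 1}.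
  apply: (@locally_lipschitz_derivable_ae _ _ K) => T s t Ts st tT.
  apply: le_trans (x_lip Ts st tT); apply: le_trans (mx_norm_le_enorm _).
  rewrite [leRHS]/Num.Def.normr/= mx_normrE.
  by apply: le_trans (le_bigmax _ _ (ord0, j)); rewrite /= !mxE.
have : {ae lebesgue_measure, forall t : R, forall j : 'I_n,
    derivable (fun r => x r ord0 j) t 1}.
  apply: filter_forall => j; exact: coord_ae.
apply: filterS; first exact: (ae_filter_ringOfSetsType lebesgue_measure).
move=> t dx; apply/derivable_mxP => i j; rewrite (ord1 i); exact: dx.
Qed.

End locally_lipschitz_curves.

(** * From the integrated inequality to the differential inclusion *)

Lemma derive1_right_ineq (R : realType) (n : nat) (x : R -> 'rV[R]_n)
    (u v : 'rV[R]_n) (t E : R) :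
  derivable x t 1 ->
  (forall h, 0 < h <= 1 -> dotp (x t - x (t + h) - h *: u) v <= E * h ^+ 2) ->
  dotp (- x^`()%classic t - u) v <= 0.
Proof.
move=> dx ineq; pose q h := h^-1 *: (x (h + t) - x t).
have q_cvg : q h @[h --> 0^'+] --> x^`()%classic t.
  apply: cvg_dnbhs_at_right.
  rewrite derive1E.
  have -> : q = fun h => h^-1 *: ((x \o shift t) (h *: 1) - x t).
    by apply/funext => h; rewrite /q /= [h *: 1]mulr1.
  exact: dx.
have lhs_cvg :
    dotp (- q h - u) v @[h --> 0^'+] --> dotp (- x^`()%classic t - u) v.
  have dotp_v : continuous (fun w : 'rV[R]_n => dotp (- w - u) v).
    apply: dotp_continuous => w; last exact: cst_continuous.
    by apply: continuousB; [exact: oppr_continuous|exact: cst_continuous].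
  exact: (cvg_comp _ _ q_cvg (dotp_v _)).
have rhs_cvg : E * h @[h --> 0^'+] --> (0 : R).
  rewrite -[X in _ --> X](mulr0 E); apply: cvg_at_right_filter.
  exact: mulrl_continuous.
(* Divided by [h], the hypothesis bounds the left side by [E * h], which tends to 0. *)
apply: (ler_cvg_to lhs_cvg rhs_cvg); near=> h.
have h_gt0 : 0 < h by near: h; exact: nbhs_right_gt.
have h_le1 : h <= 1 by near: h; exact: nbhs_right_le.
have -> : - q h - u = h^-1 *: (x t - x (t + h) - h *: u).
  rewrite [RHS]scalerBr scalerA mulVf ?gt_eqF// scale1r.
  by rewrite /q -scalerN opprB [t + h]addrC.
rewrite dotpZl ler_pdivrMl// mulrCA -expr2.
by apply: ineq; rewrite h_gt0.
Unshelve. all: by end_near. Qed.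

Theorem theorem2p1 (R : realType) (n : nat)
    (f : R -> 'rV[R]_n -> 'rV[R]_n) (C : R -> set 'rV[R]_n)
    (Lf : R) (Lf_gt0 : 0 < Lf)
    (f_lip : forall (t1 t2 : R) (x1 x2 : 'rV[R]_n),
      enorm (f t1 x1 - f t2 x2) <= Lf * `|t1 - t2| + Lf * enorm (x1 - x2))
    (C_nonempty : forall t : R, C t !=set0)
    (C_closed : forall t : R, closed (C t))
    (C_convex : forall t : R, convex_set (C t : set (convex_lmodType 'rV[R]_n)))
    (LC : R) (LC_gt0 : 0 < LC)
    (C_lip : forall t1 t2 : R,
      (hausdorff_dist (C t1) (C t2) <= (LC * `|t1 - t2|)%:E)%E)
    (M : R) (M_gt0 : 0 < M)
    (C_bounded : forall (t : R) (c : 'rV[R]_n), C t c -> enorm c <= M) :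
  exists x0 : R -> 'rV[R]_n, sweeping_solution f C [set: R] x0.
Proof.
have [x [xC x_est]] := exists_sweeping_estimate Lf_gt0 f_lip C_nonempty
  C_closed C_convex LC_gt0 C_lip M_gt0 C_bounded.
have x_lip T s t : - T <= s -> s <= t -> t <= T ->
    enorm (x t - x s) <= speed_bound f Lf LC M T * (t - s).
  by move=> Ts st tT; have [] := x_est T s t Ts st tT.
exists x; split=> [a b _ _|t _|]; [|exact: xC|].
  exact: (locally_lipschitz_abs_continuous x_lip).
have := locally_lipschitz_curve_derivable_ae x_lip.
apply: filterS; first exact: (ae_filter_ringOfSetsType lebesgue_measure).
move=> t dx _; split=> //.
exists (- x^`()%classic t - f t (x t)); last by rewrite subrK.
(* This window contains [t] and [t + h] for all [h] up to 1, so one error constant serves the whole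
   limit. *)
split=> // c Ct; pose T := `|t| + 1.
apply: (@derive1_right_ineq _ _ x _ _ _ (sweeping_error f Lf LC M T)) => // h.
move=> /andP[h_gt0 h_le1].
have [|||_ /(_ _ Ct)] := x_est T t (t + h).
- by have := lerNnormlW (lexx `|t|); rewrite /T; lra.
- by rewrite lerDl ltW.
- by rewrite lerD// ler_norm.
by rewrite (_ : t + h - t = h)//; ring.
Qed.
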